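(* Let $G\cong(0,\underbrace{1,\ldots,1}_{t_1},0,\underbrace{1,\ldots,1}_{t_2})$, where $t_1\ge 0$ and $t_2\ge 1$. (1) If $t_1=0$ and $t_2\ge 2$, then $q(G)=2$. (2) If $t_1=0$ and $t_2=1$, then $q(G)=3$. (3) If $t_1\ge 1$ and $t_2=1$, then $q(G)=3$. (4) If $t_1\ge 1$ and $t_2\ge 2$, then $q(G)=2$.
   Context: For a simple graph $G$ on $n$ vertices, $S(G)$ is the set of all real symmetric $n\times n$ matrices $A=(a_{ij})$ such that for $i\neq j$, $a_{ij}\neq 0$ if and only if $ij\in E(G)$ (diagonal entries are unrestricted). $q(A)$ is the number of distinct eigenvalues of $A$ and $q(G)=\min\{q(A): A\in S(G)\}$. The notation $G\cong(b_1,\ldots,b_n)$, with $b_i\in\{0,1\}$ and $b_1=0$, means that $G$ is the threshold graph with creation sequence $(b_1,\ldots,b_n)$: its vertices are $v_1,\ldots,v_n$ and, for $i<j$, $v_i$ and $v_j$ are adjacent if and only if $b_j=1$. *)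

(* Defs.v *)
From mathcomp Require Import all_boot all_order all_algebra.
From mathcomp Require Import finmap.
From mathcomp Require Import boolp classical_sets functions cardinality reals.

Set Implicit Arguments.
Unset Strict Implicit.
Unset Printing Implicit Defensive.

Import Order.TTheory GRing.Theory Num.Theory.
Local Open Scope classical_set_scope.
Local Open Scope ring_scope.

(* Labelled simple graphs; the labelling is what indexes the rows and columns
   of the matrices below. *)
Record sgraph (n : nat) := SGraph {
  edge :> rel 'I_n;
  edge_sym : symmetric edge;
  edge_irr : irreflexive edge }.

(* [v] is the vertex order v_1, ..., v_n, shifted to start at 0. *)
Definition threshold_with (n : nat) (G : sgraph n) (b : seq bool) : Prop :=
  [/\ size b = n, head true b = false &
   exists v : 'I_(size b) -> 'I_n, bijective v /\
     forall i j : 'I_(size b), (i < j)%N -> G (v i) (v j) = nth false b j].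

Definition symS (R : realType) (n : nat) (G : sgraph n) : set 'M[R]_n :=
  [set A : 'M[R]_n | A^T = A /\
     forall i j : 'I_n, i != j -> (A i j != 0) = G i j].

Definition spectrum (R : realType) (n : nat) (A : 'M[R]_n) : set R :=
  [set a : R | eigenvalue A a].

(* [fset_set] is the empty set on infinite sets, so this is what makes [qmx]
   below count the eigenvalues. *)
Lemma finite_spectrum (R : realType) (n : nat) (A : 'M[R]_n) :
  finite_set (spectrum A).
Proof.
have nz : char_poly A != 0 by rewrite monic_neq0 ?char_poly_monic.
suff H : forall (m : nat) (p : {poly R}), (size p <= m)%N -> p != 0 ->
    finite_set [set a : R | root p a].
  apply: sub_finite_set (H _ _ (leqnn _) nz) => a /=.
  by rewrite /spectrum /= eigenvalue_root_char.
elim=> [|m IH] p; first by rewrite leqn0 size_poly_eq0 => ->.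
move=> szp p0.
have [[a ra]|no] := pselect (exists a, root p a); last first.
  apply: (sub_finite_set _ (@finite_set0 R)) => a /= ra.
  by apply: no; exists a.
have /factor_theorem [r pE] := ra.
have r0 : r != 0 by apply: contraNneq p0 => r0; rewrite pE r0 mul0r.
have szr : (size r <= m)%N.
  by move: szp; rewrite pE size_Mmonic ?monicXsubC // size_XsubC addn2.
apply: (@sub_finite_set _ _ ([set a : R | root r a] `|` [set a])).
  by move=> x /=; rewrite pE rootM root_XsubC => /orP[|/eqP]; [left|right].
by rewrite finite_setU; split; [exact: IH|exact: finite_set1].
Qed.

Definition qmx (R : realType) (n : nat) (A : 'M[R]_n) : nat :=
  #|` fset_set (spectrum A)|.

Lemma qmx_attained (R : realType) (n : nat) (G : sgraph n) :
  exists k : nat, `[< exists2 A : 'M[R]_n, symS G A & qmx A = k >].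
Proof.
pose A : 'M[R]_n := \matrix_(i, j) (G i j)%:R.
exists (qmx A); apply/asboolP; exists A => //; split.
  by apply/matrixP => i j; rewrite !mxE edge_sym.
by move=> i j _; rewrite mxE pnatr_eq0; case: (G i j).
Qed.

Definition qgraph (R : realType) (n : nat) (G : sgraph n) : nat :=
  ex_minn (qmx_attained R G).

(* Main.v *)
(* A real symmetric matrix has at most k eigenvalues iff a nonzero polynomial of
   degree at most k annihilates it.  Upper bounds come from Gram matrices
   M^T M of vectors in the plane: such a matrix has at most three eigenvalues
   (0 and those of the 2 x 2 matrix M M^T), and at most two if M M^T is scalar.
   Orthogonal axes carry the clique on the first t1 + 1 vertices and the
   isolated vertex, the t2 dominating vertices get vectors (c_i, d) off the
   axes; M M^T can be made scalar as soon as the c_i can sum to 0, that is, when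
   t2 >= 2.  If t2 = 1, two nonadjacent vertices have the dominating vertex as
   only common neighbour, which excludes two eigenvalues. *)
Require Import Defs.
From mathcomp Require Import all_boot all_order all_algebra.
From mathcomp Require Import reals.
From mathcomp Require Import finmap boolp classical_sets cardinality.
From mathcomp Require Import spectral complex ring lra.

Set Implicit Arguments.
Unset Strict Implicit.
Unset Printing Implicit Defensive.

Import Order.TTheory GRing.Theory Num.Theory.
Local Open Scope ring_scope.

(** * Annihilating polynomials of symmetric matrices *)

(** Over [R[i]] the matrix is Hermitian, hence unitarily similar to a real diagonal matrix whose
    entries are eigenvalues of [A], so roots of [p]. *)
Lemma sym_horner_mx_eq0 (R : rcfType) n (A : 'M[R]_n.+1) (p : {poly R}) :
  A^T = A -> (forall a, eigenvalue A a -> root p a) -> horner_mx A p = 0.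
Proof.
move=> Asym pA.
pose B : 'M[R[i]%C]_n.+1 := map_mx (real_complex R) A.
have Bherm : B \is hermsymmx.
  apply: realsym_hermsym.
    apply/is_hermitianmxP; rewrite expr0 scale1r; apply/matrixP => i j.
    by rewrite !mxE -[in LHS]Asym mxE.
  by apply/mxOverP => i j; rewrite mxE; apply/complex_realP; exists (A i j).
have /hermitian_normalmx/orthomx_spectralP := Bherm.
have := hermitian_spectral_diag_real Bherm; have := spectral_unit B.
set P := spectralmx B; set d := spectral_diag B => Pu /mxOverP dreal BE.
have PB : P *m B = diag_mx d *m P by rewrite [in LHS]BE !mulmxA mulmxV ?mul1mx.
have pd i : (map_poly (real_complex R) p).[d 0 i] = 0.
  have [x dE] := elimT (complex_realP _) (dreal 0 i).
  (* Row [i] of [P] is a left eigenvector of [B]; the eigenvalue descends to [R] through the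
     characteristic polynomial. *)
  have /pA : eigenvalue A x.
    rewrite eigenvalue_root_char -(fmorph_root (real_complex R)) map_char_poly.
    rewrite /= -dE -eigenvalue_root_char; apply/eigenvalueP; exists (row i P).
      by rewrite -row_mul PB mul_diag_mx; apply/rowP => j; rewrite !mxE.
    apply: contraTneq Pu => /rowP Pi0; rewrite unitmxE (expand_det_row _ i).
    rewrite big1 ?unitr0 // => j _.
    by have := Pi0 j; rewrite !mxE => ->; rewrite mul0r.
  by rewrite dE horner_map /= => /rootP ->; rewrite rmorph0.
apply: (map_mx_inj (f := real_complex R)); rewrite map_horner_mx map_mx0 -/B BE.
rewrite horner_mx_uconjC // horner_mx_diag.
suff -> : map_mx (horner (map_poly (real_complex R) p)) d = 0.
  by rewrite raddf0 mulmx0 mul0mx.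
by apply/rowP => i; rewrite !mxE pd.
Qed.

(** The eigenvalues are roots of the minimal polynomial, which divides [p]; conversely, the product
    of ['X - a] over the distinct eigenvalues annihilates a symmetric matrix. *)
Lemma qmx_leP (R : realType) n (A : 'M[R]_n.+1) k : A^T = A ->
  (exists p : {poly R}, [/\ p != 0, (size p <= k.+1)%N & horner_mx A p = 0]) <->
  (qmx A <= k)%N.
Proof.
move=> Asym; have fin := finite_spectrum A; split => [[p [p0 szp pA0]]|qk].
  rewrite -ltnS; apply: leq_trans szp.
  apply: max_poly_roots (fset_uniq _) => //; apply/allP => a.
  rewrite in_fset_set // inE /spectrum /= eigenvalue_root_char -root_mxminpoly.
  by have /Pdiv.Field.dvdpP[q ->] := mxminpoly_min pA0; rewrite rootM orbC => ->.
exists (\prod_(a <- fset_set (spectrum A)) ('X - a%:P)); split.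
- by rewrite monic_neq0 ?monic_prod_XsubC.
- by rewrite size_prod_XsubC ltnS.
apply: sym_horner_mx_eq0 => // a ea.
by rewrite root_prod_XsubC in_fset_set // inE.
Qed.

Lemma qgraph_leq (R : realType) n (G : sgraph n) (A : 'M[R]_n) k :
  symS G A -> (qmx A <= k)%N -> (qgraph R G <= k)%N.
Proof.
move=> GA qk; rewrite /qgraph; case: ex_minnP => m _ mmin; apply: leq_trans qk.
by apply: mmin; apply/asboolP; exists A.
Qed.

Lemma qgraph_gtn (R : realType) n (G : sgraph n) k :
  (forall A : 'M[R]_n, symS G A -> (k < qmx A)%N) -> (k < qgraph R G)%N.
Proof.
by move=> H; rewrite /qgraph; case: ex_minnP => m /asboolP[A GA <-] _; apply: H.
Qed.

(** * Lower bounds from matrix entries *)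

Lemma horner_mx_size3 (R : comNzRingType) n (A : 'M[R]_n.+1) (p : {poly R}) :
  (size p <= 3)%N ->
  horner_mx A p = p`_2 *: (A *m A) + p`_1 *: A + (p`_0)%:M.
Proof.
move=> szp; rewrite [in LHS](_ : p = p`_2 *: 'X^2 + p`_1 *: 'X + (p`_0)%:P).
  by rewrite !rmorphD /= !horner_mxZ rmorphXn /= horner_mx_X horner_mx_C expr2.
apply/polyP => i; rewrite !coefD !coefZ coefXn coefX coefC.
case: i => [|[|[|i]]]; rewrite /= ?(mulr0, mulr1, addr0, add0r) //.
by rewrite nth_default // (leq_trans szp).
Qed.

(** An annihilator of degree at most 1 has zero slope by the entry at the edge [u v], then zero
    constant term by a diagonal entry. *)
Lemma leq2_qgraph (R : realType) n (G : sgraph n) u v :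
  G u v -> (2 <= qgraph R G)%N.
Proof.
case: n G u v => [|n] G u v; first by case: u.
move=> Guv; apply: qgraph_gtn => A [Asym GA]; rewrite ltnNge; apply/negP.
case/(qmx_leP _ Asym) => p [/negP p0 szp pA]; apply: p0; move: pA.
have uv : u != v by apply: contraTneq Guv => ->; rewrite edge_irr.
rewrite horner_mx_size3 ?(leq_trans szp) // (nth_default _ szp) scale0r add0r.
move=> /matrixP pA; have := pA u v; rewrite !mxE (negPf uv) mulr0n addr0.
move/eqP; rewrite mulf_eq0 (negPf (_ : A u v != 0)) ?GA // orbF => /eqP p1.
have := pA u u; rewrite !mxE eqxx mulr1n p1 mul0r add0r => p00.
apply/eqP/polyP => -[|[|i]]; rewrite coef0 // nth_default //.
exact: leq_trans szp _.
Qed.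

(* With two eigenvalues [A *m A] is a combination of [A] and the identity,
   whereas its [u, w] entry reduces to the single product [A u v * A v w]. *)
Lemma leq3_qgraph (R : realType) n (G : sgraph n) u v w :
  u != w -> ~~ G u w -> G u v -> G v w ->
  (forall x, G u x -> G x w -> x = v) -> (3 <= qgraph R G)%N.
Proof.
case: n G u v w => [|n] G u v w; first by case: u.
move=> uw Guw Guv Gvw vuniq; apply: qgraph_gtn => A GA; have [Asym Adj] := GA.
rewrite ltnNge; apply/negP => qA.
(* The edge already forces two eigenvalues, so it is enough to show that an annihilator of degree at
   most 2 has degree at most 1. *)
have := leq_trans (leq2_qgraph R Guv) (qgraph_leq GA (leqnn _)).
rewrite ltnNge => /negP; apply; apply/(qmx_leP _ Asym).
have [p [p0 szp pA0]] := iffRL (qmx_leP _ Asym) qA.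
exists p; split=> //.
have E x y : x != y -> ~~ G x y -> A x y = 0.
  by move=> xy /negPf nG; apply/eqP; rewrite -[_ == _]negbK Adj // nG.
have N x y : G x y -> A x y != 0.
  move=> Gxy; rewrite Adj //.
  by apply: contraTneq Gxy => ->; rewrite edge_irr.
have vw : v != w by apply: contraTneq Gvw => ->; rewrite edge_irr.
have uv : u != v by apply: contraTneq Guv => ->; rewrite edge_irr.
have AA : (A *m A) u w = A u v * A v w.
  rewrite mxE (bigD1 v) //= big1 ?addr0 // => x xv.
  have [<-|ux] := eqVneq u x; first by rewrite (E u w) // mulr0.
  have [->|xw] := eqVneq x w; first by rewrite (E u w) // mul0r.
  have [Gux|/(E _ _ ux) ->] := boolP (G u x); last by rewrite mul0r.
  have [Gxw|/(E _ _ xw) ->] := boolP (G x w); last by rewrite mulr0.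
  by rewrite (vuniq x) ?eqxx in xv.
move: pA0; rewrite horner_mx_size3 // => /matrixP/(_ u w).
rewrite mxE [X in X + _]mxE [X in X + _ + _]mxE AA.
rewrite !mxE (E u w) // (negPf uw) mulr0 mulr0n !addr0.
move/eqP; rewrite mulf_eq0 (negPf (mulf_neq0 (N _ _ Guv) (N _ _ Gvw))) orbF.
move=> p2.
rewrite leqNgt; apply: contraL p2 => lt2.
have szE : size p = 3%N by apply/eqP; rewrite eqn_leq szp.
by have := lead_coef_eq0 p; rewrite lead_coefE szE => ->.
Qed.

(** * Upper bounds from Gram matrices *)

(** On monomials this is [(M^T M)^(k+1) = M^T (M M^T)^k M], so an annihilator of [M M^T] yields one
    of the Gram matrix. *)
Lemma horner_mx_gram (R : comNzRingType) m n (M : 'M[R]_(m.+1, n.+1)) p :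
  horner_mx (M^T *m M) ('X * p) = M^T *m horner_mx (M *m M^T) p *m M.
Proof.
elim/poly_ind: p => [|p c IHp].
  by rewrite mulr0 !rmorph0 mulmx0 mul0mx.
rewrite mulrDr mulrA !rmorphD /= [X in X + _]rmorphM /= IHp horner_mx_X.
rewrite rmorphM /= rmorphM /= !horner_mx_X !horner_mx_C mulmxDr mulmxDl.
congr (_ + _); first by rewrite -!mulmxE !mulmxA.
by rewrite mul_mx_scalar -scalemxAl -mulmxE mul_mx_scalar.
Qed.

(** The polynomial ['X * p] annihilates the Gram matrix and has degree [size p]. *)
Lemma qgraph_gram (R : realType) m n (G : sgraph n.+1)
    (M : 'M[R]_(m.+1, n.+1)) (p : {poly R}) :
  (forall i j, i != j -> ((M^T *m M) i j != 0) = G i j) ->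
  p != 0 -> horner_mx (M *m M^T) p = 0 -> (qgraph R G <= size p)%N.
Proof.
move=> MG p0 pM; have sym : (M^T *m M)^T = M^T *m M by rewrite trmx_mul trmxK.
apply: (@qgraph_leq _ _ _ (M^T *m M)); first by split.
apply/(qmx_leP _ sym); exists ('X * p); split.
- by rewrite mulf_neq0 ?polyX_eq0.
- by rewrite mulrC size_mulX.
- by rewrite horner_mx_gram pM mulmx0 mul0mx.
Qed.

(** Adjacency depends only on the bit of the later vertex, as in the pairwise condition. The columns
    of [M] are the vectors of [z] moved to their vertices, and the order of columns does not affect
    [M M^T]. *)
Lemma threshold_gram (R : comNzRingType) m n (G : sgraph n)
    (z : seq (bool * 'cV[R]_m)) :
  threshold_with G (map fst z) ->
  pairwise (fun a b => ((a.2^T *m b.2) 0 0 != 0) == b.1) z ->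
  exists M : 'M[R]_(m, n),
    (forall i j, i != j -> ((M^T *m M) i j != 0) = G i j) /\
    M *m M^T = \sum_(a <- z) a.2 *m a.2^T.
Proof.
case=> _ _ [v [[w vK wK] vG]] /(pairwiseP (false, 0)) zP.
pose c k := (nth (false, 0) z k).2.
pose M : 'M[R]_(m, n) := \matrix_(k, j) c (w j) k 0; exists M; split.
  have ME i j : (M^T *m M) i j = ((c (w i))^T *m c (w j)) 0 0.
    by rewrite !mxE; apply: eq_bigr => k _; rewrite !mxE.
  have lt i j : (w i < w j)%N -> ((M^T *m M) i j != 0) = G i j.
    move=> ij; rewrite ME; have := vG _ _ ij; rewrite !wK => ->.
    have wz x : (w x < size z)%N by rewrite -(size_map fst) ltn_ord.
    by rewrite (nth_map (false, 0)) //; exact: (eqP (zP _ _ (wz i) (wz j) ij)).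
  move=> i j ij; case: (ltngtP (w i) (w j)) => [|ji|/val_inj/(can_inj wK) ijE].
  - exact: lt.
  - have -> : (M^T *m M) i j = (M^T *m M) j i.
      by rewrite -[in LHS](trmxK M) -trmx_mul mxE trmxK.
    by rewrite lt // edge_sym.
  - by rewrite ijE eqxx in ij.
apply/matrixP => k l; rewrite summxE mxE (reindex v) /=; last first.
  by exists w => x _; [apply: vK|apply: wK].
pose F i := (c i *m (c i)^T) k l.
rewrite (eq_bigr (fun i : 'I_(size (map fst z)) => F i)); last first.
  by move=> i _; rewrite /F !mxE vK big_ord1 !mxE.
by rewrite -(big_mkord xpredT F) size_map (big_nth (false, 0)).
Qed.

(** * Plane vectors for the creation sequence *)

Definition cvec2 (R : nzRingType) (x y : R) : 'cV[R]_2 :=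
  \col_i (if i == 0 then x else y).

Lemma dot_cvec2 (R : nzRingType) (x y x' y' : R) :
  ((cvec2 x y)^T *m cvec2 x' y') 0 0 = x * x' + y * y'.
Proof. by rewrite mxE !big_ord_recl big_ord0 !mxE addr0. Qed.

(* Two orthogonal lines represent the two components left by removing the
   dominating vertices, and the latter get vectors on neither line. *)
Definition creation_vectors (R : nzRingType) (t1 m : nat) (a c d : R) :
    seq (bool * 'cV[R]_2) :=
  ((false, cvec2 0 1) :: nseq t1 (true, cvec2 0 1)) ++
  (false, cvec2 a 0) :: (true, cvec2 c d) :: nseq m (true, cvec2 1 d).

Lemma creation_vectors_seq (R : nzRingType) t1 m (a c d : R) :
  map fst (creation_vectors t1 m a c d) =
  [:: false] ++ nseq t1 true ++ [:: false] ++ nseq m.+1 true.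
Proof. by rewrite /= map_cat map_nseq /= map_nseq. Qed.

(** The products required to be nonzero are among 1, [d], [a], [a * c], [c + d ^+ 2] and
    [1 + d ^+ 2], the last being positive; vectors on different axes give 0. *)
Lemma pairwise_creation_vectors (R : realFieldType) t1 m (a c d : R) :
  a != 0 -> c != 0 -> d != 0 -> c + d ^+ 2 != 0 ->
  pairwise (fun u v => ((u.2^T *m v.2) 0 0 != 0) == v.1)
    (creation_vectors t1 m a c d).
Proof.
move=> a0 c0 d0 cd.
have pw_nseq (T : Type) (r : rel T) k x : r x x -> pairwise r (nseq k x).
  by move=> rx; elim: k => //= k ->; rewrite all_nseq rx orbT.
have d1 : 1 + d ^+ 2 != 0 by rewrite gt_eqF // ltr_pwDl ?sqr_ge0.
rewrite /creation_vectors /= pairwise_cat /= !all_cat /= /allrel !all_nseq /=.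
rewrite !all_nseq /= !dot_cvec2 !(mul0r, mulr0, mul1r, mulr1, add0r, addr0).
rewrite -!expr2 !pw_nseq /=;
  rewrite ?dot_cvec2 ?(mul0r, mulr0, mul1r, mulr1, add0r, addr0);
  by rewrite -?expr2 ?oner_eq0 ?a0 ?c0 ?d0 ?cd ?d1 ?mulf_neq0 ?eqxx ?orbT.
Qed.

Lemma sum_creation_vectors (R : comNzRingType) t1 m (a c d : R) :
  \sum_(u <- creation_vectors t1 m a c d) u.2 *m u.2^T =
  \matrix_(i, j)
    if i == 0 then
      if j == 0 then a ^+ 2 + c ^+ 2 + m%:R else (c + m%:R) * d
    else if j == 0 then (c + m%:R) * d
    else t1.+1%:R + m.+1%:R * d ^+ 2.
Proof.
rewrite /creation_vectors /= big_cons big_cat /= !big_cons !big_nseq.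
rewrite !iter_addr_0 /=.
apply/matrixP => i j; rewrite !(mxE, mulmxnE) !big_ord1 !mxE.
by case: (i == 0); case: (j == 0); ring.
Qed.

(** The characteristic polynomial of the 2 x 2 matrix [M M^T] has size 3, so any admissible
    parameters serve. *)
Lemma qgraph_leq3 (R : realType) n t1 m (G : sgraph n) :
  threshold_with G
    ([:: false] ++ nseq t1 true ++ [:: false] ++ nseq m.+1 true) ->
  (qgraph R G <= 3)%N.
Proof.
rewrite -(@creation_vectors_seq R t1 m 1 1 1) => hG.
have [|M [MG _]] := threshold_gram hG.
  by apply: pairwise_creation_vectors; rewrite ?oner_eq0 // expr1n gt_eqF ?addr_gt0.
case: n G hG M MG => [|n] G hG M MG; first by case: hG.
rewrite -(size_char_poly (M *m M^T)); apply: qgraph_gram MG _ _.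
  by rewrite monic_neq0 ?char_poly_monic.
exact: Cayley_Hamilton.
Qed.

Lemma qgraph_leq2 (R : realType) n t1 m (G : sgraph n) :
  (0 < m)%N ->
  threshold_with G
    ([:: false] ++ nseq t1 true ++ [:: false] ++ nseq m.+1 true) ->
  (qgraph R G <= 2)%N.
Proof.
move=> m0; pose x : R := m%:R.
have x0 : 0 < x by rewrite ltr0n.
(* The choice [c = - x] makes the off-diagonal entry [(c + x) * d] vanish. With [d = x + 1] the
   lower diagonal entry is [t1.+1%:R + (x + 1) ^+ 3], and [a ^+ 2 = s] makes the upper one equal to
   it. *)
pose s : R := t1.+1%:R + (x + 1) ^+ 3 - x ^+ 2 - x.
have s0 : 0 < s.
  have : 0 < t1.+1%:R :> R by rewrite ltr0n.
  by rewrite /s; nra.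
rewrite -(@creation_vectors_seq R t1 m (Num.sqrt s) (- x) (x + 1)) => hG.
have [|M [MG ME]] := threshold_gram hG.
  apply: pairwise_creation_vectors.
  - by rewrite gt_eqF // sqrtr_gt0.
  - by rewrite oppr_eq0 gt_eqF.
  - by rewrite gt_eqF // addr_gt0.
  - by rewrite gt_eqF //; nra.
case: n G hG M MG ME => [|n] G hG M MG ME; first by case: hG.
have <- : size ('X - (t1.+1%:R + (x + 1) ^+ 3)%:P) = 2%N.
  exact: size_XsubC.
apply: qgraph_gram MG _ _.
  by rewrite monic_neq0 ?monicXsubC.
rewrite rmorphB /= horner_mx_X horner_mx_C ME sum_creation_vectors.
have -> : m.+1%:R = x + 1 by rewrite /x natr1.
apply/matrixP => -[[|[|//]] ilt] -[[|[|//]] jlt]; rewrite !mxE -!val_eqE /=;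
  by rewrite ?sqr_sqrtr ?ltW // /s -/x; ring.
Qed.

(** * Lower bounds for the creation sequence and conclusion *)

Lemma leq3_qgraph_threshold (R : realType) n t1 (G : sgraph n) :
  threshold_with G
    ([:: false] ++ nseq t1 true ++ [:: false] ++ nseq 1 true) ->
  (3 <= qgraph R G)%N.
Proof.
set b := _ ++ _ => -[_ _ [v [vbij vG]]].
have szb : size b = t1.+3 by rewrite /= size_cat size_nseq addn2.
have o0 : (0 < size b)%N by rewrite szb.
have o1 : (t1.+1 < size b)%N by rewrite szb.
have o2 : (t1.+2 < size b)%N by rewrite szb.
have nb1 : nth false b t1.+1 = false by rewrite /= nth_cat size_nseq ltnn subnn.
have nb2 : nth false b t1.+2 = true.
  by rewrite /= nth_cat size_nseq ltnNge leqnSn subSnn.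
(* The later zero of the sequence, the dominating vertex and the first vertex play [u], [v] and
   [w]. *)
apply: (@leq3_qgraph _ _ _ (v (Ordinal o1)) (v (Ordinal o2)) (v (Ordinal o0))).
- by rewrite (inj_eq (bij_inj vbij)).
- by rewrite edge_sym vG // nb1.
- by rewrite vG.
- by rewrite edge_sym vG.
case: vbij => w vK wK x; rewrite -(wK x); case: (w x) => k lk Gk _.
congr (v _); apply: val_inj => /=.
(* A neighbour of the later zero is neither that vertex itself nor an earlier one, as its bit is 0;
   only the last vertex remains. *)
move: (lk); rewrite szb ltnS leq_eqVlt => /orP[/eqP //|].
rewrite ltnS leq_eqVlt => /orP[/eqP kE|ltk].
  by move: Gk; rewrite (_ : Ordinal lk = Ordinal o1) ?edge_irr //; apply: val_inj.
by move: Gk; rewrite edge_sym vG // nb1.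
Qed.

Lemma leq2_qgraph_threshold (R : realType) n t1 m (G : sgraph n) :
  threshold_with G
    ([:: false] ++ nseq t1 true ++ [:: false] ++ nseq m.+1 true) ->
  (2 <= qgraph R G)%N.
Proof.
set b := _ ++ _ => -[_ _ [v [_ vG]]].
have szb : size b = (t1 + m.+2).+1 by rewrite /= size_cat /= !size_nseq.
have o0 : (0 < size b)%N by rewrite szb.
have o2 : (t1.+2 < size b)%N by rewrite szb !ltnS -addn2 leq_add2l.
apply: (@leq2_qgraph _ _ _ (v (Ordinal o0)) (v (Ordinal o2))); rewrite vG //=.
by rewrite nth_cat size_nseq ltnNge leqnSn subSnn.
Qed.

Theorem theorem8p1 (R : realType) (n t1 t2 : nat) (G : sgraph n)
    (ht2 : (1 <= t2)%N)
    (hG : threshold_with G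
            ([:: false] ++ nseq t1 true ++ [:: false] ++ nseq t2 true)) :
  [/\ (t1 = 0%N -> (2 <= t2)%N -> qgraph R G = 2%N),
      (t1 = 0%N -> t2 = 1%N -> qgraph R G = 3%N),
      ((1 <= t1)%N -> t2 = 1%N -> qgraph R G = 3%N) &
      ((1 <= t1)%N -> (2 <= t2)%N -> qgraph R G = 2%N)].
Proof.
have q2 : (2 <= t2)%N -> qgraph R G = 2%N.
  case: t2 ht2 hG => // m _ hG m0; apply/eqP.
  by rewrite eqn_leq (qgraph_leq2 _ m0 hG) (leq2_qgraph_threshold _ hG).
have q3 : t2 = 1%N -> qgraph R G = 3%N.
  move=> t2E; rewrite t2E in hG; apply/eqP.
  by rewrite eqn_leq (qgraph_leq3 (m := 0) _ hG) (leq3_qgraph_threshold _ hG).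
by split=> _ //.
Qed.
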